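(* There exists a deterministic two-party communication protocol that, given an $n$-vertex graph $G$ (with Alice holding edge set $E_A$ and Bob holding edge set $E_B$, disjoint, on a common vertex set $V$ known to both, $G=(V,E_A\cup E_B)$), computes the degeneracy $\kappa(G)$ using $O(n\log^3 n)$ bits of communication. Moreover, the protocol outputs a $\kappa(G)$-ordering of the vertices of $G$ and a $\kappa(G)$-core of $G$.
   Context: For an undirected graph $G=(V,E)$ and integer $k\ge1$, a $k$-core is a maximal set $S\subseteq V$ such that $G[S]$ has minimum degree at least $k$; the degeneracy $\kappa(G)$ is the largest $k\ge0$ such that $G$ contains a non-empty $k$-core. For an ordering $\sigma$ of $V$, $\mathrm{odeg}_\sigma(v)$ is the number of neighbors of $v$ appearing after $v$ in $\sigma$; $\sigma$ is a $k$-ordering if $\mathrm{odeg}_\sigma(v)\le k$ for all $v\in V$. *)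

(* Defs.v *)
From mathcomp Require Import all_boot.

Set Implicit Arguments.
Unset Strict Implicit.
Unset Printing Implicit Defensive.

(* Deterministic two-party protocols as binary trees.  At an inner node the
   speaking party sends one bit, a function of that party's own input only (the
   bits sent before are recorded by the position in the tree); [false] leads to
   the first subtree.  The output is a function of the transcript alone. *)
Inductive protocol (X Y Z : Type) : Type :=
  | Output of Z
  | Alice of (X -> bool) & protocol X Y Z & protocol X Y Z
  | Bob of (Y -> bool) & protocol X Y Z & protocol X Y Z.

Fixpoint run (X Y Z : Type) (P : protocol X Y Z) (x : X) (y : Y) : Z :=
  match P with
  | Output z => z
  | Alice f P0 P1 => if f x then run P1 x y else run P0 x y
  | Bob g P0 P1 => if g y then run P1 x y else run P0 x y
  end.

(* Worst-case number of bits exchanged. *)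
Fixpoint cost (X Y Z : Type) (P : protocol X Y Z) : nat :=
  match P with
  | Output _ => 0
  | Alice _ P0 P1 => (maxn (cost P0) (cost P1)).+1
  | Bob _ P0 P1 => (maxn (cost P0) (cost P1)).+1
  end.

Section Graphs.
Variable V : finType.
Implicit Types (E : {set {set V}}) (S : {set V}) (s : seq V) (v : V) (k : nat).

(* A simple undirected graph on V is given by its set of edges, each of which
   is an unordered pair of distinct vertices. *)
Definition edge_set E : bool := [forall e in E, #|e| == 2].

Definition neighbors E v : {set V} := [set u | [set v; u] \in E].

Definition degree E v : nat := #|neighbors E v|.

Definition induced E S : {set {set V}} := [set e in E | e \subset S].

Definition min_degree_geq E S k : bool :=
  [forall v in S, k <= degree (induced E S) v].

Definition kcore E k S : bool := maxset (fun T => min_degree_geq E T k) S.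

Definition has_nonempty_kcore E k : bool :=
  [exists S : {set V}, (S != set0) && kcore E k S].

(* The range k < #|V| loses nothing, since degrees are less than #|V|; see
   [degeneracyP]. *)
Definition degeneracy E : nat :=
  \max_(k < #|V| | has_nonempty_kcore E k) k.

Definition ordering s : bool := uniq s && [forall v, v \in s].

Definition odeg E s v : nat :=
  #|[set u in neighbors E v | index v s < index u s]|.

Definition kordering E k s : bool :=
  ordering s && [forall v, odeg E s v <= k].

Lemma degeneracyP E : edge_set E -> 0 < #|V| ->
  has_nonempty_kcore E (degeneracy E) /\
  (forall k, has_nonempty_kcore E k -> k <= degeneracy E).
Proof.
move=> edgE V_gt0; split.
  have core0 : has_nonempty_kcore E (Ordinal V_gt0).
    apply/existsP; exists setT; rewrite -card_gt0 cardsT V_gt0 /=.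
    apply/maxsetP; split; first by apply/forall_inP.
    by move=> B _ /subsetP sTB; apply/setP=> x; rewrite !inE sTB ?inE.
  have [|k kP kE] := @eq_bigmax_cond _
      [pred k : 'I_#|V| | has_nonempty_kcore E k] (@nat_of_ord _).
    by apply/card_gt0P; exists (Ordinal V_gt0).
  by rewrite /degeneracy kE.
move=> k kP; have ltkV : k < #|V|.
  case/existsP: kP => S /andP[/set0Pn[v vS] /maxsetp/forall_inP/(_ v vS) le_k].
  apply: leq_ltn_trans le_k _; rewrite -[#|V|]cardsT.
  apply: proper_card; apply/properP; split; first exact: subsetT.
  exists v; rewrite ?inE // setUid; apply/negP=> /andP[/(forall_inP edgE)].
  by rewrite cards1.
exact: (@leq_bigmax_cond _ (fun j : 'I_#|V| => has_nonempty_kcore E j)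
  (@nat_of_ord _) (Ordinal ltkV)).
Qed.

End Graphs.

(* Main.v *)
(** Peel the graph while a level [k] rises. Both players know the peeled vertices
    and, for each remaining vertex, an upper bound on each player's residual
    degree; the slack of a vertex is the sum of its two bounds minus [k]. A vertex
    of slack 0 has residual degree at most [k] and is peeled for free. A player
    whose bound for [v] exceeds the truth by at least half the slack of [v]
    announces [v] and the true value, which at least halves the slack, so every
    vertex is announced O(log n) times, at O(log n) bits each. If nobody has
    anything to announce, the two bounds together exceed the true degree by less than
    the slack, hence all degrees exceed [k]: the remaining set is the (k+1)-core, and [k] is incremented. *)
Require Import Defs.
From mathcomp Require Import all_boot zify.

Set Implicit Arguments.
Unset Strict Implicit.
Unset Printing Implicit Defensive.

(** * Sending an element of a finite type in a fixed number of bits *)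

Section Sending.
Variables X Y Z : Type.

Fixpoint send_nat (p : bool) (j : nat) (f : X -> nat) (g : Y -> nat)
    (c : nat -> protocol X Y Z) : protocol X Y Z :=
  if j is j'.+1 then
    let next b := send_nat p j' (half \o f) (half \o g) (fun i => c (b + i.*2)) in
    if p then Bob (odd \o g) (next false) (next true)
    else Alice (odd \o f) (next false) (next true)
  else c 0.

Lemma run_send_nat p j f g c x y : (if p then g y else f x) < 2 ^ j ->
  run (send_nat p j f g c) x y = run (c (if p then g y else f x)) x y.
Proof.
elim: j f g c => [|j IHj] f g c; first by rewrite expn0 ltnS leqn0 => /eqP->.
rewrite expnS mul2n => lt_m; case: p IHj lt_m => IHj lt_m /=.
  by rewrite -[in RHS](odd_double_half (g y)); case: (odd _); rewrite IHj //= ltn_half_double.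
by rewrite -[in RHS](odd_double_half (f x)); case: (odd _); rewrite IHj //= ltn_half_double.
Qed.

Lemma cost_send_nat p j f g c B :
  (forall i, cost (c i) <= B) -> cost (send_nat p j f g c) <= j + B.
Proof.
elim: j f g c => [|j IHj] f g c leB //=.
by case: p IHj => IHj; rewrite addSn ltnS geq_max !IHj.
Qed.

Variable M : finType.

(** The default [m0] only fills leaves for indices beyond [enum M], which no input reaches. *)
Definition send (p : bool) (j : nat) (m0 : M) (f : X -> M) (g : Y -> M)
    (c : M -> protocol X Y Z) : protocol X Y Z :=
  send_nat p j (fun x => index (f x) (enum M)) (fun y => index (g y) (enum M))
    (fun i => c (nth m0 (enum M) i)).

Lemma run_send p j m0 f g c x y : #|M| <= 2 ^ j ->
  run (send p j m0 f g c) x y = run (c (if p then g y else f x)) x y.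
Proof.
move=> leM; have ltM m : index m (enum M) < 2 ^ j.
  by apply: leq_trans leM; rewrite cardE index_mem mem_enum.
rewrite /send run_send_nat; last by case: p.
by case: p; rewrite nth_index ?mem_enum.
Qed.

Lemma cost_send p j m0 f g c B :
  (forall m, cost (c m) <= B) -> cost (send p j m0 f g c) <= j + B.
Proof. by move=> leB; apply: cost_send_nat. Qed.

End Sending.

(** * Residual degrees and the peeling protocol *)

Section Peeling.
Variable V : finType.
Implicit Types (E EA EB : {set {set V}}) (S X : {set V}) (s : seq V) (v : V) (p : bool).

Definition residual_degree E s v := #|[set u in neighbors E v | u \notin s]|.

Lemma residual_degree_le_card E s v : residual_degree E s v <= #|V|.
Proof. exact: max_card. Qed.

Lemma residual_degree_rcons E s v w :
  residual_degree E (rcons s w) v <= residual_degree E s v.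
Proof.
apply/subset_leq_card/subsetP => u; rewrite !inE mem_rcons inE negb_or.
by case/and3P=> -> _ ->.
Qed.

(** Disjoint edge sets give disjoint neighborhoods, so bounds that each player justifies privately
    add up to a bound in the whole graph. *)
Lemma residual_degreeU EA EB s v : [disjoint EA & EB] ->
  residual_degree (EA :|: EB) s v
    = residual_degree EA s v + residual_degree EB s v.
Proof.
move=> dis; rewrite /residual_degree -cardsUI.
rewrite (_ : _ :&: _ = set0) ?cards0 ?addn0; last first.
  apply/setP=> u; rewrite !inE; apply/negP=> /andP[/andP[uA _] /andP[uB _]].
  by have := disjointFr dis uA; rewrite uB.
by congr #|pred_of_set _|; apply/setP=> u; rewrite !inE andb_orl.
Qed.

Lemma degree_induced E S v : v \in S ->
  degree (induced E S) v = #|neighbors E v :&: S|.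
Proof.
move=> vS; rewrite /degree; congr #|pred_of_set _|; apply/setP=> u.
by rewrite !inE subUset !sub1set vS.
Qed.

Lemma residual_degree_induced E s v : v \notin s ->
  degree (induced E [set u | u \notin s]) v = residual_degree E s v.
Proof.
move=> vs; rewrite degree_induced ?inE //.
by congr #|pred_of_set _|; apply/setP=> u; rewrite !inE.
Qed.

(** A core of a level above [k] has minimum degree at least [k.+1], hence would be empty. *)
Lemma degeneracyE E k S : edge_set E -> S != set0 -> kcore E k S ->
  (forall X, min_degree_geq E X k.+1 -> X = set0) -> degeneracy E = k.
Proof.
move=> edgeE S0 coreS noX.
have V_gt0 : 0 < #|V| by case/set0Pn: S0 => v _; apply/card_gt0P; exists v.
have [/existsP[T /andP[T0 /maxsetp minT]] maxk] := degeneracyP edgeE V_gt0.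
apply/eqP; rewrite eqn_leq maxk ?andbT; last by apply/existsP; exists S; rewrite S0.
rewrite leqNgt; apply/negP=> lt_k; case/eqP: T0; apply: noX.
by apply/forall_inP=> v /(forall_inP minT); apply: leq_trans.
Qed.

(* Alice is [false] and Bob is [true]. *)
Record state := State {
  peeled : seq V;
  level : nat;
  core : {set V};
  bound : bool -> V -> nat }.
Implicit Type st : state.

(** Subtraction is truncated: slack 0 means that the bounds sum to at most the level. *)
Definition slack st v := bound st false v + bound st true v - level st.

Definition peel_vertex st v :=
  State (rcons (peeled st) v) (level st) (core st) (bound st).

Definition raise_level st :=
  State (peeled st) (level st).+1 [set v | v \notin peeled st] (bound st).

Definition set_bound st p v d :=
  State (peeled st) (level st) (core st)
    (fun q u => if (q == p) && (u == v) then d else bound st q u).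

Definition alarm E st p v :=
  (v \notin peeled st) &&
  (slack st v <= (bound st p v - residual_degree E (peeled st) v).*2).

Definition message E st p : option (V * 'I_#|V|.+1) :=
  omap (fun v => (v, inord (residual_degree E (peeled st) v))) [pick v | alarm E st p v].

Definition announce j st p c : protocol {set {set V}} {set {set V}} (nat * seq V * {set V}) :=
  send p j None (fun E => message E st p) (fun E => message E st p) c.

(** Both tests before the announcements read only the public state, so they cost no bits; a free
    peeling still uses one unit of fuel. *)
Fixpoint peeling (j fuel : nat) st :
    protocol {set {set V}} {set {set V}} (nat * seq V * {set V}) :=
  let result := Output _ _ (level st, peeled st, core st) in
  if fuel isn't fuel'.+1 then result else
  if [pick v | (v \notin peeled st) && (slack st v == 0)] is Some v
  then peeling j fuel' (peel_vertex st v) else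
  if [forall v, v \in peeled st] then result else
  announce j st false (fun mA =>
    if mA is Some (v, d) then peeling j fuel' (set_bound st false v d) else
    announce j st true (fun mB =>
      if mB is Some (v, d) then peeling j fuel' (set_bound st true v d)
      else peeling j fuel' (raise_level st))).

(** Each round has at most two messages of [j] bits. *)
Lemma cost_peeling j fuel st : cost (peeling j fuel st) <= fuel * j.*2.
Proof.
elim: fuel st => [|fuel IH] st //=.
case: pickP => [v _|_]; first by apply: leq_trans (IH _) _; rewrite leq_mul2r leqnSn orbT.
case: ifP => // _; rewrite mulSn -addnn -addnA.
apply: cost_send => -[[v d]|]; first by apply: leq_trans (IH _) _; rewrite -addnn leq_addl.
apply: cost_send => -[[v d]|]; rewrite addnn; exact: IH.
Qed.

(** Bounds the number of remaining rounds. Doubling the slack inside the logarithm separates slack 1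
    from slack 0, the successor pays for peeling the vertex, and the last term pays for raising the
    level. *)
Definition potential st :=
  \sum_(v | v \notin peeled st) (trunc_log 2 (slack st v).*2).+1 + (#|V| - level st).

Section Correctness.
Variables EA EB : {set {set V}}.
Hypotheses (edgeA : edge_set EA) (edgeB : edge_set EB) (disAB : [disjoint EA & EB]).
Let G := EA :|: EB.
Let input p := if p then EB else EA.

(** [inv_next] gives maximality of the next core when the level rises, and rules out higher cores
    once all vertices are peeled. In [inv_odeg], unpeeled vertices count as later, their index being
    the length of the sequence. *)
Record invariant st : Prop := Invariant {
  inv_uniq : uniq (peeled st);
  inv_core : kcore G (level st) (core st);
  inv_core0 : core st != set0;
  inv_next : forall X, min_degree_geq G X (level st).+1 ->
    X \subset [set v | v \notin peeled st];
  inv_odeg : forall v, v \in peeled st -> odeg G (peeled st) v <= level st;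
  inv_bound : forall p v, residual_degree (input p) (peeled st) v <= bound st p v }.

Definition correct (r : nat * seq V * {set V}) : Prop :=
  let: (k, s, T) := r in
  [/\ k = degeneracy G, kordering G (degeneracy G) s & kcore G (degeneracy G) T].

Lemma correct_result st : invariant st -> [forall v, v \in peeled st] ->
  correct (level st, peeled st, core st).
Proof.
case=> us cs c0 ns os bs /forallP all_s.
have dE : degeneracy G = level st.
  apply: degeneracyE cs _ => //.
    by apply/forall_inP=> e; rewrite inE => /orP[/(forall_inP edgeA)|/(forall_inP edgeB)].
  move=> X /ns; rewrite (_ : [set v | _] = set0) ?subset0 => [/eqP //|].
  by apply/setP=> v; rewrite !inE all_s.
rewrite /correct dE; split=> //; rewrite /kordering /ordering us /=.
by apply/andP; split; apply/forallP=> v; [apply: all_s | apply: os].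
Qed.

(** The residual degree of [v] is at most the level, so [v] lies in no set of larger minimum degree
    among the remaining vertices, and its later neighbors are residual ones. *)
Lemma invariant_peel_vertex st v : invariant st -> v \notin peeled st ->
  slack st v = 0 -> invariant (peel_vertex st v).
Proof.
case: st => s k T bd [/= us cs c0 ns os bs] vs sl0.
have dv : residual_degree G s v <= k.
  rewrite /G residual_degreeU //; have := bs false v; have := bs true v.
  by move: sl0; rewrite /slack /=; lia.
split=> //= [|X minX|w|p w].
- by rewrite rcons_uniq vs.
- have sX := ns X minX; apply/subsetP=> u uX.
  have := subsetP sX u uX; rewrite !inE mem_rcons inE negb_or => ->; rewrite andbT.
  apply: contraTneq uX => ->; apply/negP=> vX.
  have := forall_inP minX v vX; rewrite degree_induced // ltnNge => /negP[].
  apply: leq_trans dv; apply/subset_leq_card/subsetP=> u'.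
  by rewrite !inE => /andP[-> /(subsetP sX)]; rewrite inE.
- rewrite mem_rcons inE; case: (eqVneq w v) => [->|wv] /= ws.
    apply: leq_trans dv; apply/subset_leq_card/subsetP=> u.
    rewrite !inE -cats1 !index_cat (negPf vs) /= eqxx addn0 => /andP[->] /=.
    by apply: contraTN => us'; rewrite us' -leqNgt ltnW ?index_mem.
  (* For an older [w], the vertices outside [s] already counted as later, so appending [v] adds
     none. *)
  apply: leq_trans (os w ws); apply/subset_leq_card/subsetP=> u.
  rewrite !inE -cats1 !index_cat ws => /andP[->] /=.
  by case: ifP => // /negbT us'; rewrite (memNindex us') index_mem ws.
- exact: leq_trans (residual_degree_rcons _ _ _ _) (bs p w).
Qed.

Lemma invariant_set_bound st p v : invariant st ->
  invariant (set_bound st p v (residual_degree (input p) (peeled st) v)).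
Proof.
case=> us cs c0 ns os bs; split=> //= q w.
by case: ifP => // /andP[/eqP-> /eqP->].
Qed.

(** Silence also forces a positive slack, so the truncation in [slack] is harmless. *)
Lemma residual_degree_gt_level st v : invariant st -> v \notin peeled st ->
  (forall p, ~~ alarm (input p) st p v) ->
  level st < residual_degree G (peeled st) v.
Proof.
move=> inv vs noA; rewrite /G residual_degreeU //.
have := inv_bound inv false v; have := inv_bound inv true v.
have := noA false; have := noA true; rewrite /alarm vs /= -!ltnNge /slack; lia.
Qed.

Lemma invariant_raise_level st : invariant st -> ~~ [forall v, v \in peeled st] ->
  (forall p v, ~~ alarm (input p) st p v) -> invariant (raise_level st).
Proof.
move=> inv /forallPn[w ws] noA; case: (inv) => us cs c0 ns os bs.
split=> //= [||X minX|v /os].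
- apply/maxsetP; split.
    apply/forall_inP=> v; rewrite inE => vs; rewrite residual_degree_induced //.
    exact: residual_degree_gt_level.
  by move=> B minB sB; apply/eqP; rewrite eqEsubset sB ns.
- by apply/set0Pn; exists w; rewrite inE.
- by apply: ns; apply/forall_inP=> v /(forall_inP minX); apply: ltnW.
- exact: leqW.
Qed.

Lemma potential_peel_vertex st v : v \notin peeled st ->
  potential (peel_vertex st v) < potential st.
Proof.
move=> vs; rewrite /potential [in X in _ < X](bigD1 v) //=.
rewrite (eq_bigl (fun u => (u \notin peeled st) && (u != v))).
  by rewrite -addnA addSn ltnS leq_addl.
by move=> u; rewrite mem_rcons inE negb_or andbC.
Qed.

(** Twice the new slack is at most the old one, so the logarithm drops by at least one; this needs a
    nonzero old slack. *)
Lemma potential_set_bound st p v : alarm (input p) st p v -> slack st v != 0 ->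
  potential (set_bound st p v (residual_degree (input p) (peeled st) v))
    < potential st.
Proof.
case/andP=> vs alv sl0; rewrite /potential /= ltn_add2r.
rewrite [in X in X < _](bigD1 v) //= [in X in _ < X](bigD1 v) //=.
rewrite [X in _ + X < _](eq_bigr (fun u => (trunc_log 2 (slack st u).*2).+1)).
  rewrite ltn_add2r ltnS [X in _ < X]trunc_log2_double ?lt0n // ltnS.
  apply: leq_trunc_log; move: alv sl0; rewrite /slack /= eqxx.
  by case: p; rewrite /= -!muln2; lia.
by move=> u /andP[_ /negPf uv]; rewrite /slack /= uv !andbF.
Qed.

Lemma potential_raise_level st : level st < #|V| ->
  potential (raise_level st) < potential st.
Proof.
move=> ltV; rewrite /potential -addnS; apply: leq_add; last exact: ltn_sub2l.
apply: leq_sum => v _; rewrite ltnS; apply: leq_trunc_log.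
by rewrite leq_double leq_sub2l /=.
Qed.

Lemma run_announce j st p c : #|{: option (V * 'I_#|V|.+1)}| <= 2 ^ j ->
  run (announce j st p c) EA EB = run (c (message (input p) st p)) EA EB.
Proof. by move=> leM; rewrite run_send //; case: p. Qed.

Lemma correct_peeling j fuel st : #|{: option (V * 'I_#|V|.+1)}| <= 2 ^ j ->
  invariant st -> potential st <= fuel -> correct (run (peeling j fuel st) EA EB).
Proof.
move=> leM; elim: fuel st => [|fuel IH] st inv le_fuel.
  (* Every remaining vertex contributes at least 1, so zero potential means that all are peeled. *)
  apply: correct_result => //; apply/forallP=> v; apply/contraT=> vs.
  by move: le_fuel; rewrite /potential (bigD1 v).
rewrite [peeling _ _ _]/=; case: pickP => [v /andP[vs /eqP sl0]|no_sl0].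
  apply: IH; first exact: invariant_peel_vertex.
  by rewrite -ltnS (leq_trans _ le_fuel) ?potential_peel_vertex.
case: ifPn => [|not_all]; first exact: correct_result.
have announced p v d : message (input p) st p = Some (v, d) ->
    correct (run (peeling j fuel (set_bound st p v d)) EA EB).
  rewrite /message; case: pickP => //= {}v al [<- <-].
  rewrite inordK ?ltnS ?residual_degree_le_card //.
  apply: IH; first exact: invariant_set_bound.
  rewrite -ltnS (leq_trans _ le_fuel) ?potential_set_bound //.
  by have := no_sl0 v; case/andP: al => -> _ /= ->.
have silent p : message (input p) st p = None -> forall v, ~~ alarm (input p) st p v.
  by rewrite /message; case: pickP => //= no _ v; rewrite no.
rewrite run_announce //; case mA: (message _ _ _) => [[v d]|]; first exact: announced.
rewrite run_announce //; case mB: (message _ _ _) => [[v d]|]; first exact: announced.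
have noA p v : ~~ alarm (input p) st p v by case: p; apply: silent.
apply: IH; first exact: invariant_raise_level.
rewrite -ltnS (leq_trans _ le_fuel) // potential_raise_level //.
(* A remaining vertex has residual degree above the level, which keeps the level below [#|V|]. *)
case/forallPn: not_all => w ws.
exact: leq_trans (residual_degree_gt_level inv ws (noA ^~ w)) (residual_degree_le_card _ _ _).
Qed.

End Correctness.

Definition initial_state := State [::] 0 [set: V] (fun _ _ => #|V|).

Lemma invariant_initial_state EA EB : 0 < #|V| -> invariant EA EB initial_state.
Proof.
move=> V_gt0; split=> //= [||X _|p v].
- apply/maxsetP; split; first by apply/forall_inP.
  by move=> B _ sTB; apply/eqP; rewrite eqEsubset subsetT.
- by rewrite -card_gt0 cardsT.
- by apply/subsetP=> v; rewrite inE.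
- exact: residual_degree_le_card.
Qed.

(** The initial slack is 2n; its double 4n has logarithm L + 2, giving n(L + 3) plus n for the
    levels. *)
Lemma potential_initial_state : 0 < #|V| ->
  potential initial_state <= #|V| * (trunc_log 2 #|V| + 4).
Proof.
move=> V_gt0; rewrite /potential /= subn0 /slack /= subn0 addnn.
rewrite !trunc_log2_double ?double_gt0 // sum_nat_const.
by rewrite (eq_card (_ : _ =i V)) // -mulnSr addn4.
Qed.

(** With n + 1 <= 2^(L+1), the count 1 + n(n + 1) is at most (n + 1)^2. *)
Lemma card_message : #|{: option (V * 'I_#|V|.+1)}| <= 2 ^ (trunc_log 2 #|V|).+1.*2.
Proof.
rewrite card_option card_prod card_ord -addnn expnD.
have := trunc_log_ltn #|V| (isT : 1 < 2); nia.
Qed.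

End Peeling.

Lemma edge_set_card1 (V : finType) (E : {set {set V}}) :
  #|V| = 1 -> edge_set E -> E = set0.
Proof.
move=> V1 /forall_inP edgeE; apply/setP=> e; rewrite inE; apply/negP=> /edgeE /eqP e2.
by have := max_card (mem e); rewrite e2 V1.
Qed.

Theorem theorem6p1 :
  exists C : nat, forall V : finType, 0 < #|V| ->
    exists P : protocol {set {set V}} {set {set V}} (nat * seq V * {set V}),
      cost P <= C * (#|V| * trunc_log 2 #|V| ^ 3) /\
      forall EA EB : {set {set V}},
        edge_set EA -> edge_set EB -> [disjoint EA & EB] ->
        let G := EA :|: EB in
        let: (k, s, T) := run P EA EB in
        [/\ k = degeneracy G, kordering G (degeneracy G) s
          & kcore G (degeneracy G) T].
Proof.
(* For L >= 1, n(L + 4) rounds of 4(L + 1) bits cost at most n * 5L * 8L = 40nL^2, which is within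
   the cubic bound. *)
exists 40 => V V_gt0; set L := trunc_log 2 #|V|.
pose P := peeling L.+1.*2 (#|V| * (L + 4)) (initial_state V).
have corrP EA EB : edge_set EA -> edge_set EB -> [disjoint EA & EB] ->
    correct EA EB (run P EA EB).
  move=> edgeA edgeB dis; apply: correct_peeling => //.
  - exact: card_message.
  - exact: invariant_initial_state.
  - exact: potential_initial_state.
case: (leqP #|V| 1) => [V_le1|V_gt1].
  (* The bound is 0 here, but there is a single possible input. *)
  have V1 : #|V| = 1 by apply/eqP; rewrite eqn_leq V_le1.
  exists (Output _ _ (run P set0 set0)); split=> // EA EB edgeA edgeB dis.
  by have := corrP EA EB edgeA edgeB dis; rewrite (edge_set_card1 V1 edgeA) (edge_set_card1 V1 edgeB).
exists P; split; last exact: corrP.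
apply: leq_trans (cost_peeling _ _ _) _.
have L_gt0 : 0 < L by rewrite trunc_log_gt0.
rewrite mulnCA -mulnA leq_mul2l; apply/orP; right.
by rewrite -!muln2 !expnS expn0; nia.
Qed.
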